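(* Let $n\ge 2$ and $k\ge 0$, and let $D$ be the weighted strand diagram consisting of a single crossing of size $n$ with no dots. Then \[ \operatorname{tr}^{\,n-1}(\partial_k D)=(n-2)!\sum_{i=2}^{n}\Big[(i-1)\,h_{n-i}\,\partial_{k+i-1}S+(k+i-n)\,h_{k+i-1}\,\partial_{n-i}S\Big], \] where $S$ denotes the single strand with no dots.
   Context: Let $\Lambda$ be the ring of symmetric functions, $h_m$ the complete homogeneous symmetric functions ($h_0=1$) and $p_m$ the power sum symmetric functions. A weighted crossing of size $m\ge1$ is a tuple $(a_1,\dots,a_m)$ of nonnegative integers, thought of as a single crossing of $m$ strands with $a_i$ dots decorating the top of strand $i$; for $m=1$ it is a single strand with $a_1$ dots, denoted $S^{a_1}$ (and $S=S^0$). We work in the free $\Lambda$-module with basis the weighted crossings. The trace $\operatorname{tr}$ is the $\Lambda$-linear map defined on a weighted crossing of size $m\ge2$ by removing the last strand and either multiplying by $p_{a_m+1}$ or adding $a_m+1$ dots to one of the remaining strands: \[\operatorname{tr}(a_1,\dots,a_m)=p_{a_m+1}(a_1,\dots,a_{m-1})+\sum_{i=1}^{m-1}(a_1,\dots,a_i+a_m+1,\dots,a_{m-1}).\] (On a single strand, $\operatorname{tr}(S^{a})=p_{a+1}$.) $\operatorname{tr}^{n-1}$ is the $(n-1)$-fold iterate. For a weighted diagram $D$, $D^j$ denotes $D$ with $j$ extra dots on its right-most strand, and $\partial_kD=\sum_{j=0}^{k}h_{k-j}D^j$; in particular $\partial_k S=\sum_{j=0}^k h_{k-j}S^j$. *)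

(* Defs.v *)
From HB Require Import structures.
From Stdlib Require Import FunctionalExtensionality.
From mathcomp Require Import all_boot all_order all_algebra.
From mathcomp Require Import perm finmap boolp.
From mathcomp Require Import mpoly.

Set Implicit Arguments.
Unset Strict Implicit.
Unset Printing Implicit Defensive.

Import GRing.Theory.
Local Open Scope ring_scope.

(** The ring of symmetric functions (with integer coefficients) is realized as
    the inverse limit, in the category of graded rings (hence the degree bound
    in [is_symfun]), of the rings of symmetric polynomials in n variables along
    the maps that set the last variable to 0. *)

Definition last_var_to_0 (n : nat) : {mpoly int[n.+1]} -> {mpoly int[n]} :=
  mmap (@mpolyC n int)
       (fun i : 'I_n.+1 =>
          if unlift ord_max i is Some j then 'X_(j : 'I_n) else 0).

Fact last_var_to_0_additive n : zmod_morphism (@last_var_to_0 n).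
Proof. by move=> p q; apply: mmapB. Qed.

Fact last_var_to_0_multiplicative n : monoid_morphism (@last_var_to_0 n).
Proof. by case: (mmap_is_multiplicative (n := n.+1) (R := int)
  (fun i : 'I_n.+1 => if unlift ord_max i is Some j then 'X_(j : 'I_n) else 0)
  (@mpolyC n int)). Qed.

HB.instance Definition _ n :=
  GRing.isZmodMorphism.Build {mpoly int[n.+1]} {mpoly int[n]} (@last_var_to_0 n)
    (@last_var_to_0_additive n).
HB.instance Definition _ n :=
  GRing.isMonoidMorphism.Build {mpoly int[n.+1]} {mpoly int[n]}
    (@last_var_to_0 n) (@last_var_to_0_multiplicative n).

Definition is_symfun (f : forall n, {mpoly int[n]}) : Prop :=
  [/\ forall n, f n \is symmetric,
      forall n, last_var_to_0 (f n.+1) = f n &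
      exists d, forall n, (msize (f n) <= d)%N].

Record symfun := SymFun {
  symfun_val :> forall n, {mpoly int[n]};
  symfun_prop : is_symfun symfun_val
}.

Lemma symfunP (f g : symfun) : (forall n, f n = g n) -> f = g.
Proof.
case: f g => [f fP] [g gP] /= fg.
have E : f = g by apply: functional_extensionality_dep.
by move: gP; rewrite -E => gP; rewrite (Prop_irrelevance fP gP).
Qed.

HB.instance Definition _ := gen_eqMixin symfun.
HB.instance Definition _ := gen_choiceMixin symfun.

Fact sf_zero_subproof : is_symfun (fun n => 0).
Proof.
split=> [n|n|]; first exact: rpred0.
  exact: rmorph0.
by exists 0%N => n; rewrite mmeasure0.
Qed.

Fact sf_one_subproof : is_symfun (fun n => 1).
Proof.
split=> [n|n|]; first exact: rpred1.
  exact: rmorph1.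
by exists 1%N => n; rewrite msize1.
Qed.

Fact sf_opp_subproof (f : symfun) : is_symfun (fun n => - f n).
Proof.
case: f => f [fS fR [d fd]]; split=> [n|n|] /=; first by rewrite rpredN; apply: fS.
  by rewrite rmorphN /= fR.
by exists d => n; rewrite mmeasureN.
Qed.

Fact sf_add_subproof (f g : symfun) : is_symfun (fun n => f n + g n).
Proof.
case: f g => f [fS fR [d fd]] [g [gS gR [e ge]]]; split=> [n|n|] /=.
- exact: rpredD (fS n) (gS n).
- by rewrite rmorphD /= fR gR.
exists (maxn d e) => n; apply: leq_trans (mmeasureD_le _ _ _) _.
by rewrite geq_max !leq_max fd ge orbT.
Qed.

Fact sf_mul_subproof (f g : symfun) : is_symfun (fun n => f n * g n).
Proof.
case: f g => f [fS fR [d fd]] [g [gS gR [e ge]]]; split=> [n|n|] /=.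
- exact: rpredM (fS n) (gS n).
- by rewrite rmorphM /= fR gR.
exists (d + e)%N => n; have [->|fn0] := eqVneq (f n) 0.
  by rewrite mul0r mmeasure0.
have [->|gn0] := eqVneq (g n) 0; first by rewrite mulr0 mmeasure0.
by rewrite msizeM //; apply: leq_trans (leq_pred _) (leq_add (fd n) (ge n)).
Qed.

Definition sf_zero : symfun := SymFun sf_zero_subproof.
Definition sf_one : symfun := SymFun sf_one_subproof.
Definition sf_opp (f : symfun) : symfun := SymFun (sf_opp_subproof f).
Definition sf_add (f g : symfun) : symfun := SymFun (sf_add_subproof f g).
Definition sf_mul (f g : symfun) : symfun := SymFun (sf_mul_subproof f g).

Fact sf_addA : associative sf_add.
Proof. by move=> f g h; apply: symfunP => n /=; rewrite addrA. Qed.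
Fact sf_addC : commutative sf_add.
Proof. by move=> f g; apply: symfunP => n /=; rewrite addrC. Qed.
Fact sf_add0 : left_id sf_zero sf_add.
Proof. by move=> f; apply: symfunP => n /=; rewrite add0r. Qed.
Fact sf_addN : left_inverse sf_zero sf_opp sf_add.
Proof. by move=> f; apply: symfunP => n /=; rewrite addNr. Qed.

HB.instance Definition _ :=
  GRing.isZmodule.Build symfun sf_addA sf_addC sf_add0 sf_addN.

Fact sf_mulA : associative sf_mul.
Proof. by move=> f g h; apply: symfunP => n /=; rewrite mulrA. Qed.
Fact sf_mulC : commutative sf_mul.
Proof. by move=> f g; apply: symfunP => n /=; rewrite mulrC. Qed.
Fact sf_mul1 : left_id sf_one sf_mul.
Proof. by move=> f; apply: symfunP => n /=; rewrite mul1r. Qed.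
Fact sf_mulDl : left_distributive sf_mul sf_add.
Proof. by move=> f g h; apply: symfunP => n /=; rewrite mulrDl. Qed.
Fact sf_one_neq0 : sf_one != 0 :> symfun.
Proof.
by apply/eqP => /(congr1 (fun f : symfun => f 0%N)) /eqP; rewrite /= oner_eq0.
Qed.

HB.instance Definition _ := GRing.Zmodule_isComNzRing.Build symfun
  sf_mulA sf_mulC sf_mul1 sf_mulDl sf_one_neq0.

(** The coefficients of [last_var_to_0 p] are those of the monomials of [p] in
    which the last variable does not occur. *)

Lemma last_var_to_0X n (m : 'X_{1..n.+1}) :
  last_var_to_0 'X_[m] =
  if m ord_max == 0%N
  then 'X_[ [multinom m (widen_ord (leqnSn n) i) | i < n] ] else 0.
Proof.
rewrite /last_var_to_0 mmapX /mmap1 big_ord_recr /= unlift_none.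
rewrite expr0n; case: eqP => [_|_]; last by rewrite mulr0.
rewrite mulr1 mpolyXE_id; apply: eq_bigr => i _; rewrite mnmE.
have -> : widen_ord (leqnSn n) i = lift ord_max i.
  by apply: val_inj; rewrite /= /bump leqNgt ltn_ord.
by rewrite liftK.
Qed.

Lemma last_var_to_0_coeff n (p : {mpoly int[n.+1]}) (m : 'X_{1..n}) :
  (last_var_to_0 p)@_m = p@_(mnmwiden m).
Proof.
rewrite [in LHS](mpolyE p) [in RHS](mpolyE p) rmorph_sum /= !raddf_sum /=.
apply: eq_bigr => k _.
rewrite -mul_mpolyC rmorphM /= {1}/last_var_to_0 mmapC !mcoeffCM; congr (_ * _).
rewrite last_var_to_0X mcoeffX; case: eqP => [k0|k0].
  rewrite mcoeffX; congr (nat_of_bool _)%:R; apply/eqP/eqP => [<-|->].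
    apply/mnmP => i; case: (unliftP ord_max i) => [j|] -> {i}.
      have <- : widen_ord (leqnSn n) j = lift ord_max j.
        by apply: val_inj; rewrite /= /bump leqNgt ltn_ord.
      by rewrite mnmwiden_widen mnmE.
    by rewrite mnmwiden_ordmax.
  by apply/mnmP => i; rewrite mnmE mnmwiden_widen.
rewrite mcoeff0; case: eqP => // E; case: k0.
by rewrite E mnmwiden_ordmax.
Qed.

Definition complete_mpoly (k n : nat) : {mpoly int[n]} :=
  \sum_(m : 'X_{1..n < k.+1} | mdeg m == k) 'X_[m].

Lemma mcoeff_complete k n (m : 'X_{1..n}) :
  (complete_mpoly k n)@_m = (mdeg m == k)%:R.
Proof.
rewrite /complete_mpoly raddf_sum /=; have [mk|mk] := eqVneq (mdeg m) k.
  have lt_m : (mdeg m < k.+1)%N by rewrite mk.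
  rewrite (bigD1 (BMultinom lt_m)) /= ?mk // mcoeffX eqxx big1 ?addr0 //.
  move=> u /andP[_ um]; rewrite mcoeffX; case: eqP => // E.
  by case/eqP: um; apply: val_inj.
rewrite big1 // => u /eqP uk; rewrite mcoeffX; case: eqP => // E.
by case/eqP: mk; rewrite -E.
Qed.

Fact complete_subproof k : is_symfun (complete_mpoly k).
Proof.
split=> [n|n|].
- apply/issymP => s; apply/mpolyP => m.
  by rewrite mcoeff_sym !mcoeff_complete mdeg_mperm.
- apply/mpolyP => m; rewrite last_var_to_0_coeff !mcoeff_complete; congr (_ == _)%:R.
  by rewrite !mdegE big_ord_recr /= mnmwiden_ordmax addn0; apply: eq_bigr => i _;
     rewrite mnmwiden_widen.
exists k.+1 => n; apply: leq_trans (mmeasure_sum _ _ _ _) _.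
by apply/bigmax_leqP => m /eqP mk; rewrite msizeX mk.
Qed.

Definition sf_h (k : nat) : symfun := SymFun (complete_subproof k).

Definition powersum_mpoly (k n : nat) : {mpoly int[n]} := \sum_(i < n) 'X_i ^+ k.

Fact powersumS_subproof k : is_symfun (powersum_mpoly k.+1).
Proof.
split=> [n|n|].
- apply/issymP => s; rewrite /powersum_mpoly raddf_sum /=.
  rewrite [RHS](reindex_inj (@perm_inj _ s)) /=; apply: eq_bigr => i _.
  by rewrite /msym rmorphXn /= mmapX mmap1U.
- rewrite /powersum_mpoly rmorph_sum big_ord_recr /= !rmorphXn /=.
  rewrite {2}/last_var_to_0 mmapX mmap1U unlift_none expr0n addr0.
  apply: eq_bigr => i _; rewrite rmorphXn /= /last_var_to_0 mmapX mmap1U.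
  have -> : widen_ord (leqnSn n) i = lift ord_max i.
    by apply: val_inj; rewrite /= /bump leqNgt ltn_ord.
  by rewrite liftK.
exists k.+2 => n; apply: leq_trans (mmeasure_sum _ _ _ _) _.
by apply/bigmax_leqP => i _; rewrite mpolyXn msizeX mdegMn mdeg1 mul1n.
Qed.

(** [sf_pS k] is p_{k+1}: there is no symmetric function p_0, since the number
    of variables does not define a compatible family. *)
Definition sf_pS (k : nat) : symfun := SymFun (powersumS_subproof k).

(** [monalg] is imported only here, as its names and notations clash with those
    of [mpoly]. *)

From mathcomp Require Import monalg.

(** The weighted crossing (a_1, ..., a_m) is the list [:: a_1; ...; a_m]. The
    empty list stands for the empty diagram: the trace of a single strand S^a,
    which is the scalar p_{a+1}, is here p_{a+1} times the empty diagram. *)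
Definition wcrossing : Type := seq nat.
HB.instance Definition _ := Choice.on wcrossing.

Definition wmod : Type := {malg symfun[wcrossing]}.
HB.instance Definition _ := GRing.Lmodule.on wmod.

Definition diag (s : wcrossing) : wmod := << s >>.

(** The last strand, with [a] dots, is removed and [t] lists the remaining ones.
    The value on the empty diagram, which has no strand to close, is a
    convention. *)
Definition tr_basis (s : wcrossing) : wmod :=
  if s is a1 :: s' then
    let a := last a1 s' in let t := belast a1 s' in
    sf_pS a *: diag t +
    \sum_(i < size t) diag (set_nth 0%N t i (nth 0%N t i + a + 1)%N)
  else 0.

Definition tr (g : wmod) : wmod := \sum_(s <- msupp g) mcoeff s g *: tr_basis s.

Fact tr_is_linear : linear tr.
Proof.
have trw (g : wmod) (d : {fset wcrossing}) : (msupp g `<=` d)%fset ->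
    tr g = \sum_(s <- d) mcoeff s g *: tr_basis s.
  move=> le_gd; rewrite /tr (big_fset_incl _ le_gd) //= => s _ /mcoeff_outdom ->.
  by rewrite scale0r.
move=> c f g; pose d := (msupp f `|` msupp g `|` msupp (c *: f + g))%fset.
rewrite (trw f d) ?(trw g d) ?(trw (c *: f + g) d).
- rewrite scaler_sumr -big_split /=; apply: eq_bigr => s _.
  by rewrite mcoeffD mcoeffZ scalerDl scalerA.
- exact: fsubsetUr.
- exact: fsubset_trans (fsubsetUr _ _) (fsubsetUl _ _).
exact: fsubset_trans (fsubsetUl _ _) (fsubsetUl _ _).
Qed.

HB.instance Definition _ := GRing.isLinear.Build symfun wmod wmod *:%R tr
  tr_is_linear.

Lemma tr_diag (s : wcrossing) : tr (diag s) = tr_basis s.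
Proof. by rewrite /tr msuppU oner_eq0 big_seq_fset1 mcoeffUU scale1r. Qed.

Definition add_dots (j : nat) (s : wcrossing) : wcrossing :=
  if s is a1 :: s' then rcons (belast a1 s') (last a1 s' + j)%N else s.

Definition dpartial (k : nat) (s : wcrossing) : wmod :=
  \sum_(0 <= j < k.+1) sf_h (k - j) *: diag (add_dots j s).

Definition crossing (n : nat) : wcrossing := nseq n 0%N.
Definition strand : wcrossing := [:: 0%N].

(* Main.v *)
(** The iterated trace does not depend on the order of the strands that it
    closes. Hence, when a dotted last strand is closed and the other strands
    still to be closed carry no dots, all the terms in which its dots land on
    one of these have the same iterated trace, and
    [tr ^ (r+1) (a, 0, ..., 0, d)] (with [r] zeros) satisfies a recursion that
    involves only crossings of this form. Its solution is
      [r! * sum_(t <= r) (p_(d+t+1) U(a, r-t) + U(a+d+t+1, r-t))],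
    where [U(a, r) = sum_c h_(r-c) S^(a+c)]; for [d = 0] it collapses to
    [(r+1)! U(a, r+1)] by Newton's identity
    [m h_m = p_1 h_(m-1) + ... + p_m h_0]. Summing over [d] against [h_(k-d)]
    and using Newton's identity again gives the formula. *)

From HB Require Import structures.
Require Import Defs.
From mathcomp Require Import all_boot all_order all_algebra.
From mathcomp Require Import mpoly.
From mathcomp Require Import zify ring.

Set Implicit Arguments.
Unset Strict Implicit.
Unset Printing Implicit Defensive.

Import GRing.Theory.
Local Open Scope ring_scope.

(** * Convolution identities that follow from Newton's identity *)

Section Convolutions.
Variables (R : comNzRingType) (M : lmodType R).
Variables (h p : nat -> R) (e : nat -> M).
(* Here [p t] stands for the power sum p_(t+1). *)
Hypothesis newton : forall r, h r.+1 *+ r.+1 = \sum_(t < r.+1) p t * h (r - t).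

(** This is [U(a, r)]: when [e b] is the strand with [b] dots, it is the operator of index [r] in
    the theorem applied to the strand with [a] dots. *)
Definition hsum a r : M := \sum_(c < r.+1) h (r - c) *: e (a + c).

Lemma hsum0 a : hsum a 0 = h 0 *: e a.
Proof. by rewrite /hsum big_ord1 subn0 addn0. Qed.

Lemma hsumS a r : hsum a r.+1 = h r.+1 *: e a + hsum a.+1 r.
Proof.
rewrite /hsum big_ord_recl /= subn0 addn0; congr (_ + _).
by apply: eq_bigr => c _; rewrite /bump /= add1n subSS addnS addSn.
Qed.

(** The iterated trace of [(a, 0, ..., 0, d)] with [r] zeros, divided by [r!]. *)
Definition trsum a r d : M :=
  \sum_(t < r.+1) (p (d + t) *: hsum a (r - t) + hsum (a + d + t).+1 (r - t)).

Lemma trsumS a r d :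
  trsum a r.+1 d = p d *: hsum a r.+1 + hsum (a + d).+1 r.+1 + trsum a r d.+1.
Proof.
rewrite /trsum big_ord_recl /= subn0 !addn0; congr (_ + _).
by apply: eq_bigr => t _; rewrite /bump /= add1n subSS !addnS !addSn.
Qed.

(** In the induction step, peeling the [e a] term off each [hsum a _] gives [(r+2) h_(r+2) e_a] by
    Newton's identity. The rest is [hsum a.+1 r.+1] plus [trsum a.+1 r 0], that is, [r+2] copies of
    [hsum a.+1 r.+1]. *)
Lemma trsum_newton a r : trsum a r 0 = hsum a r.+1 *+ r.+1.
Proof.
elim: r a => [|r IHr] a.
  rewrite /trsum big_ord1 !addn0 subn0 hsumS !hsum0 mulr1n scalerA.
  by have := newton 0; rewrite big_ord1 mulr1n => ->.
have splitE b m : trsum b m 0 =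
    \sum_(t < m.+1) p t *: hsum b (m - t)
    + \sum_(t < m.+1) hsum (b + t).+1 (m - t).
  rewrite -big_split; apply: eq_bigr => t _.
  by rewrite add0n addn0.
have hsumE : \sum_(t < r.+2) p t *: hsum a (r.+1 - t) =
    (h r.+2 *+ r.+2) *: e a + \sum_(t < r.+1) p t *: hsum a.+1 (r - t).
  rewrite newton scaler_suml [LHS]big_ord_recr [X in _ = X + _]big_ord_recr /=.
  rewrite subnn hsum0 !scalerA addrAC -big_split /=; congr (_ + _).
  apply: eq_bigr => t _; have le_t : (t <= r)%N by rewrite -ltnS.
  by rewrite (subSn le_t) hsumS scalerDr scalerA.
rewrite splitE hsumE [X in _ + X]big_ord_recl /= subn0 addn0.
rewrite addrCA -addrA [X in _ + (_ + X)](_ : _ = trsum a.+1 r 0).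
  by rewrite IHr addrCA -mulrS [in RHS]hsumS mulrnDl scalerMnl.
rewrite splitE; congr (_ + _); apply: eq_bigr => t _.
by rewrite /bump /= add1n subSS addnS addSn.
Qed.

(** In the coefficient of [e (a + i)] both sides collect the products [h u * h v] with
    [u + v = k + r + 1 - i] and [u <= r]; the two sums on the left separate [v <= k] from
    [v > k]. *)
Lemma hsum_exchange a k r :
  \sum_(j < k.+1) h (k - j) *: hsum (a + j).+1 r
    + \sum_(c < r.+1) h (k + c).+1 *: hsum a (r - c)
  = \sum_(c < r.+1) h (r - c) *: hsum a (k + c).+1.
Proof.
elim: r k => [|r IHr] k.
  rewrite !big_ord1 addn0 subn0 hsum0 hsumS scalerDr addrC !scalerA mulrC.
  congr (_ + _); rewrite /hsum scaler_sumr; apply: eq_bigr => j _.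
  by rewrite -/(hsum _ _) hsum0 !scalerA mulrC addSn.
rewrite [in RHS]big_ord_recl /= subn0 addn0 hsumS scalerDr scalerA.
rewrite [X in _ + X = _]big_ord_recl /= subn0 addn0 hsumS scalerDr scalerA.
under eq_bigr do rewrite hsumS scalerDr scalerA.
rewrite big_split /=.
rewrite (_ : \sum_(j < k.+1) _ = h r.+1 *: hsum a.+1 k); last first.
  rewrite /hsum scaler_sumr; apply: eq_bigr => j _.
  by rewrite scalerA mulrC addSn.
rewrite [X in _ = _ + X](_ : _ =
    \sum_(c < r.+1) h (r - c) *: hsum a (k.+1 + c).+1); last first.
  by apply: eq_bigr => c _; rewrite /bump /= add1n subSS addnS addSn.
rewrite -IHr [in RHS]big_ord_recl /= subn0 addn0.
rewrite [X in _ = _ + (_ + X + _)](_ : _ =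
    \sum_(j < k.+1) h (k - j) *: hsum (a + j).+2 r); last first.
  by apply: eq_bigr => c _; rewrite /bump /= add1n subSS addnS.
rewrite [X in _ + (_ + X) = _](_ : _ =
    \sum_(c < r.+1) h (k.+1 + c).+1 *: hsum a (r - c)); last first.
  by apply: eq_bigr => c _; rewrite /bump /= add1n subSS addnS addSn.
rewrite [h k.+1 * _]mulrC.
by rewrite [LHS](AC (2*(2*1)) ((3*1)*((4*2)*5))).
Qed.

Lemma sum_trsum a k r :
  \sum_(j < k.+1) h (k - j) *: trsum a r j =
  \sum_(c < r.+1) ((c.+1%:R * h (r - c)) *: hsum a (k + c).+1
     + (((k + c)%:R - r%:R) * h (k + c).+1) *: hsum a (r - c)).
Proof.
have newton_rev n : \sum_(j < n.+1) h (n - j) * p j = h n.+1 *+ n.+1.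
  by rewrite newton; apply: eq_bigr => j _; rewrite mulrC.
elim: r k => [|r IHr] k.
  rewrite big_ord1 addn0 subn0 hsum0 hsumS !subr0 mul1r.
  under eq_bigr do rewrite /trsum big_ord1 !addn0 subn0 !hsum0 scalerDr !scalerA.
  rewrite big_split /= -scaler_suml -mulr_suml.
  rewrite newton_rev /hsum scalerDr [in RHS]addrAC !scalerA -scalerDl scaler_sumr.
  congr (_ *: _ + _); first by rewrite mulrS; ring.
  by apply: eq_bigr => j _; rewrite scalerA mulrC addSn.
(* [trsumS] raises [d], which leads to the sum at [(k.+1, r)] without its [d = 0] term;
   [trsum_newton] evaluates that term. *)
have shift : \sum_(j < k.+1) h (k - j) *: trsum a r j.+1 =
    \sum_(j < k.+2) h (k.+1 - j) *: trsum a r j - (h k.+1 *+ r.+1) *: hsum a r.+1.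
  rewrite [in RHS]big_ord_recl /= subn0 trsum_newton -scalerMnl.
  rewrite scalerMnr addrAC subrr add0r.
  by apply: eq_bigr => j _; rewrite /bump /= add1n subSS.
under eq_bigr do rewrite trsumS !scalerDr scalerA.
rewrite 2!big_split /= shift -scaler_suml.
rewrite newton_rev IHr.
have/(canRL (addrK _)) -> := hsum_exchange a k r.+1.
rewrite [in RHS]big_split /= [X in _ = X + _]big_ord_recl.
rewrite [X in _ = _ + X]big_ord_recl /=.
rewrite [X in _ + (X - _) + _]big_ord_recl [X in _ + (_ - X) + _]big_ord_recl /=.
rewrite !subn0 !addn0 mul1r.
rewrite [X in _ = X + _](_ : _ = h r.+1 *: hsum a k.+1 +
    \sum_(c < r.+1) (h (r - c) *: hsum a (k.+1 + c).+1
      + (c.+1%:R * h (r - c)) *: hsum a (k.+1 + c).+1)); last first.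
  congr (_ + _); apply: eq_bigr => c _.
  rewrite /bump /= add1n subSS addnS addSn -scalerDl.
  by rewrite [in RHS]mulrSr; congr (_ *: _); ring.
rewrite [X in _ = _ + (_ + X)](_ : _ =
    \sum_(c < r.+1) (((k.+1 + c)%:R - r%:R) * h (k.+1 + c).+1 *: hsum a (r - c)
      - h (k.+1 + c).+1 *: hsum a (r - c))); last first.
  apply: eq_bigr => c _.
  rewrite /bump /= add1n subSS addnS addSn -scalerBl; congr (_ *: _).
  by rewrite [r.+1%:R]mulrSr; ring.
rewrite !big_split /= sumrN.
rewrite [X in _ + (_ + X - _) + _](_ : _ =
    \sum_(c < r.+1) h (r - c) *: hsum a (k.+1 + c).+1); last first.
  by apply: eq_bigr => c _; rewrite /bump /= add1n subSS addnS addSn.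
rewrite [X in _ + (_ - (_ + X)) + _](_ : _ =
    \sum_(c < r.+1) h (k.+1 + c).+1 *: hsum a (r - c)); last first.
  by apply: eq_bigr => c _; rewrite /bump /= add1n subSS addnS addSn.
(* The coefficient of [hsum a r.+1] receives [k+1] times [h k.+1] from Newton's identity, [-1] times
   from the exchange and [-(r+1)] times from the removed [d = 0] term. *)
have -> : (k%:R - r.+1%:R) * h k.+1 = h k.+1 *+ k.+1 - h k.+1 - h k.+1 *+ r.+1.
  by rewrite -[h k.+1 *+ k.+1]mulr_natl -[h k.+1 *+ r.+1]mulr_natl mulrSr; ring.
rewrite 2!scalerBl !opprD.
by rewrite [LHS](AC (1*(2*2)*(2*1)) ((2*(3*6))*((1*4*8)*(7*5)))).
Qed.
End Convolutions.

(** * Newton's identity for symmetric functions *)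

Lemma sf_h0 : sf_h 0 = 1.
Proof.
apply: symfunP => n; apply/mpolyP => m.
by rewrite mcoeff_complete mcoeff1 mdeg_eq0.
Qed.

Lemma mcoeff_XnM n (i : 'I_n) t (q : {mpoly int[n]}) (m : 'X_{1..n}) :
  ('X_i ^+ t * q)@_m = if (t <= m i)%N then q@_(m - U_(i) *+ t)%MM else 0.
Proof.
have [le_t|lt_t] := leqP t (m i).
  have le_m : (U_(i) *+ t <= m)%MM.
    apply/mnm_lepP => j; rewrite mulmnE mnm1E.
    by case: eqP => [<-|_]; rewrite ?mul1n.
  by rewrite mpolyXn mulrC -{1}(submK le_m) addmC mcoeffMX.
rewrite mpolyXn mulrC mcoeffMr big1 // => -[k1 k2] /= /eqP def_m.
rewrite mcoeffX; case: eqP => [def_k|]; last by rewrite ?mulr0 ?mul0r.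
have := congr1 (fun m' : 'X_{1..n} => m' i) def_m.
rewrite mnmDE -def_k mulmnE mnm1E eqxx mul1n => def_mi.
by move: lt_t; rewrite def_mi ltnNge leq_addr.
Qed.

Lemma mcoeff_powersum_complete n t k (m : 'X_{1..n}) :
  (powersum_mpoly t n * complete_mpoly k n)@_m =
    (mdeg m == k + t)%N%:R * \sum_(i < n) (t <= m i)%:R.
Proof.
rewrite /powersum_mpoly mulr_suml raddf_sum mulr_sumr /=.
apply: eq_bigr => i _; rewrite mcoeff_XnM mcoeff_complete.
case: leqP => [le_t|_]; last by rewrite mulr0.
have le_m : (U_(i) *+ t <= m)%MM.
  apply/mnm_lepP => j; rewrite mulmnE mnm1E.
  by case: eqP => [<-|_]; rewrite ?mul1n.
by rewrite -{2}(submK le_m) mdegD mdegMn mdeg1 mul1n eqn_add2r mulr1.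
Qed.

Lemma sum_ltn_ord n N : (\sum_(t < N) (t < n) = minn n N)%N.
Proof.
elim: N => [|N IHN]; first by rewrite big_ord0 minn0.
by rewrite big_ord_recr /= IHN; lia.
Qed.

(** In a monomial [m] of degree [r+1], the exponent of variable [i] exceeds [t] for exactly [m i]
    values of [t], and these counts add up to the degree. *)
Lemma sf_newton r :
  sf_h r.+1 *+ r.+1 = \sum_(t < r.+1) sf_pS t * sf_h (r - t).
Proof.
apply: symfunP => n; apply/mpolyP => m.
have sf_evalB : zmod_morphism (fun f : symfun => f n) by [].
pose ev : {additive symfun -> {mpoly int[n]}} :=
  HB.pack (fun f : symfun => f n) (GRing.isZmodMorphism.Build _ _ _ sf_evalB).
rewrite -[LHS]/((ev _)@_m) -[RHS]/((ev _)@_m) raddfMn !raddf_sum /=.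
rewrite mcoeffMn mcoeff_complete.
under eq_bigr => t _ do rewrite mcoeff_powersum_complete addnS subnK -1?ltnS //.
rewrite -mulr_sumr -[LHS]mulr_natr; case: eqP => [deg_m|_]; last by rewrite !mul0r.
rewrite !mul1r exchange_big /= -deg_m [in LHS]mdegE natr_sum.
apply: eq_bigr => i _.
have le_mi : (m i <= mdeg m)%N by rewrite mdegE (bigD1 i) //= leq_addr.
by rewrite -natr_sum sum_ltn_ord (minn_idPl le_mi).
Qed.

(* The notations of [monalg] clash with those of [mpoly], used so far. *)
From mathcomp Require Import monalg.

(** * Linearity of the iterated trace and independence of the strand order *)

Lemma iter_tr_linear m : linear (iter m tr).
Proof. by elim: m => // m IHm c f g; rewrite /= IHm linearP. Qed.
HB.instance Definition _ m :=
  GRing.isLinear.Build symfun wmod wmod *:%R (iter m tr) (iter_tr_linear m).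

Lemma iter_trD m f g : iter m tr (f + g) = iter m tr f + iter m tr g.
Proof. exact: linearD. Qed.

Lemma iter_trZ m c f : iter m tr (c *: f) = c *: iter m tr f.
Proof. exact: linearZ. Qed.

Lemma iter_tr_sum m (I : Type) (r : seq I) (F : I -> wmod) :
  iter m tr (\sum_(i <- r) F i) = \sum_(i <- r) iter m tr (F i).
Proof. exact: (linear_sum (iter m tr)). Qed.

(* The ways to add [d] dots to one of the strands of [s]. *)
Fixpoint bumps (d : nat) (s : seq nat) : seq (seq nat) :=
  if s is x :: s' then (x + d :: s')%N :: map (cons x) (bumps d s') else [::].

Lemma size_bumps d s u : u \in bumps d s -> size u = size s.
Proof.
elim: s u => //= x s IHs u; rewrite inE => /predU1P[->//|/mapP[v v_s ->]].
by rewrite /= (IHs v).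
Qed.

Lemma sum_bumps_cons (V : zmodType) d x s (F : seq nat -> V) :
  \sum_(u <- bumps d (x :: s)) F u =
    F (x + d :: s)%N + \sum_(u <- bumps d s) F (x :: u).
Proof. by rewrite /= big_cons big_map. Qed.

Lemma sum_bumps_cat (V : zmodType) d s1 s2 (F : seq nat -> V) :
  \sum_(u <- bumps d (s1 ++ s2)) F u =
    \sum_(u <- bumps d s1) F (u ++ s2) + \sum_(u <- bumps d s2) F (s1 ++ u).
Proof.
elim: s1 F => [|x s1 IHs] F; first by rewrite big_nil add0r.
by rewrite cat_cons !sum_bumps_cons IHs addrA.
Qed.

Lemma sum_bumps_exchange (V : zmodType) d1 d2 s (F : seq nat -> V) :
  \sum_(u <- bumps d1 s) \sum_(v <- bumps d2 u) F v =
  \sum_(u <- bumps d2 s) \sum_(v <- bumps d1 u) F v.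
Proof.
elim: s F => [|x s IHs] F; first by rewrite !big_nil.
rewrite !sum_bumps_cons.
under [X in _ + X = _]eq_bigr do rewrite sum_bumps_cons.
under [X in _ = _ + X]eq_bigr do rewrite sum_bumps_cons.
by rewrite !big_split /= IHs addnAC addrACA.
Qed.

(** Invariance of [F] is asked only for tails of length [n], which adding dots preserves; this is
    what the induction in [iter_tr_swap] can supply. *)
Lemma sum_bumps_swap (V : zmodType) d (F : seq nat -> V) n t x y w :
    size w = n ->
    (forall t x y w, size w = n -> F (t ++ x :: y :: w) = F (t ++ y :: x :: w)) ->
  \sum_(u <- bumps d (t ++ x :: y :: w)) F u =
  \sum_(u <- bumps d (t ++ y :: x :: w)) F u.
Proof.
move=> w_n swapF; rewrite !sum_bumps_cat !sum_bumps_cons; congr (_ + _).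
  by apply: eq_bigr => u _; apply: swapF.
rewrite addrCA swapF // [X in _ + (X + _)]swapF //; congr (_ + (_ + _)).
rewrite big_seq [in RHS]big_seq; apply: eq_bigr => u /size_bumps u_w.
by apply: swapF; rewrite u_w.
Qed.

Lemma tr_rcons t x :
  tr (diag (rcons t x)) = sf_pS x *: diag t + \sum_(u <- bumps x.+1 t) diag u.
Proof.
rewrite tr_diag /tr_basis.
have -> : bumps x.+1 t =
    [seq set_nth 0%N t i (nth 0%N t i + x.+1)%N | i <- iota 0 (size t)].
  elim: t => //= y t ->; congr (_ :: _); rewrite -map_comp (iotaDl 1 0).
  by rewrite -map_comp; apply: eq_map.
case def_s: (rcons t x) => [|a s]; first by case: (t) def_s.
have [-> ->] : belast a s = t /\ last a s = x.
  by move: def_s; rewrite (lastI a s) => /rcons_inj[-> ->].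
pose F i := diag (set_nth 0%N t i (nth 0%N t i + x + 1)%N).
congr (_ + _); rewrite big_map -[in LHS](big_mkord xpredT F) /index_iota subn0.
by apply: eq_bigr => i _; rewrite /F -addnA addn1.
Qed.

(** When the dots of the last strand land on the other closed strand, that strand has [a + b + 1]
    dots, which is symmetric in [a] and [b]. The remaining terms are symmetric because additions of
    dots to [t] commute. *)
Lemma tr_tr_swap t x y :
  tr (tr (diag (rcons (rcons t x) y))) = tr (tr (diag (rcons (rcons t y) x))).
Proof.
have E a b : tr (tr (diag (rcons (rcons t a) b))) =
    (sf_pS b * sf_pS a) *: diag t
    + (sf_pS b *: \sum_(u <- bumps a.+1 t) diag u
       + sf_pS a *: \sum_(u <- bumps b.+1 t) diag u)
    + \sum_(u <- bumps b.+1 t) \sum_(v <- bumps a.+1 u) diag v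
    + (sf_pS (a + b).+1 *: diag t + \sum_(u <- bumps (a + b).+2 t) diag u).
  rewrite -[LHS]/(iter 1 tr (tr _)) tr_rcons iter_trD iter_trZ.
  rewrite iter_tr_sum /= -cats1 sum_bumps_cat.
  rewrite sum_bumps_cons big_nil addr0 !cats1 !tr_rcons scalerDr scalerA addnS.
  under [\sum_(u <- _) tr _]eq_bigr do rewrite cats1 tr_rcons.
  by rewrite big_split /= -scaler_sumr !addrA.
rewrite !E sum_bumps_exchange (mulrC (sf_pS x)) (addnC x).
by rewrite [_ *: _ + _ *: \sum_(u <- bumps y.+1 _) _]addrC.
Qed.

(** Closing the last strand of [w] is compatible with the swap, so [n] reduces to 0, where
    [tr_tr_swap] applies. *)
Lemma iter_tr_swap t x y w n : size w = n ->
  iter n.+2 tr (diag (t ++ x :: y :: w)) =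
  iter n.+2 tr (diag (t ++ y :: x :: w)).
Proof.
elim: n => [|n IH] in t x y w *; case/lastP: w => [|w z].
- move=> _.
  have E a b : t ++ [:: a; b] = rcons (rcons t a) b by rewrite -!cats1 -catA.
  by rewrite /= !E tr_tr_swap.
- by rewrite size_rcons => H; discriminate H.
- by move=> H; discriminate H.
rewrite size_rcons => -[w_n]; rewrite ![iter _.+3 tr _]iterSr.
rewrite -!rcons_cons -!rcons_cat !tr_rcons.
rewrite !iter_trD !iter_trZ !iter_tr_sum (IH _ _ _ _ w_n).
by rewrite (sum_bumps_swap z.+1 t x y w_n IH).
Qed.

Lemma iter_tr_move t x w n : size w = n ->
  iter n.+1 tr (diag (t ++ x :: w)) = iter n.+1 tr (diag (t ++ rcons w x)).
Proof.
elim: w => [|y w IHw] in t n *; first by move=> _.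
case: n => [|n]; [by move=> H; discriminate H | move=> [w_n]].
rewrite (iter_tr_swap _ _ _ w_n) iterS -cat_rcons.
by rewrite (IHw _ _ w_n) cat_rcons.
Qed.

Lemma sum_bumps_zeros t d r :
  \sum_(u <- bumps d (nseq r.+1 0%N)) iter r.+1 tr (diag (t ++ u)) =
  iter r.+1 tr (diag (t ++ rcons (nseq r 0%N) d)) *+ r.+1.
Proof.
elim: r => [|r IHr] in t *; first by rewrite /= big_seq1 mulr1n.
rewrite sum_bumps_cons [X in _ = X]mulrS (iter_tr_move _ _ (size_nseq _ _)).
congr (_ + _).
(* The leading undotted strand joins the prefix; the induction hypothesis treats the inner [r.+1]
   traces. *)
under eq_bigr do rewrite -cat_rcons iterS.
rewrite -(iter_tr_sum 1) IHr [LHS](raddfMn (iter 1 tr)) cat_rcons.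
by congr (_ *+ _).
Qed.

(** * Evaluation of the iterated traces *)

Definition sf_hsum := hsum sf_h (fun a => diag [:: a]).
Definition sf_trsum := trsum sf_h sf_pS (fun a => diag [:: a]).

Lemma dpartial_strand k : dpartial k strand = sf_hsum 0 k.
Proof. by rewrite /dpartial big_mkord. Qed.

Lemma add_dots_crossing j r :
  add_dots j (crossing r.+2) = 0%N :: rcons (nseq r 0%N) j.
Proof.
rewrite /=; have -> : last 0%N (nseq r 0%N) = 0%N by elim: r.
by congr (_ :: rcons _ _); elim: r => //= r ->.
Qed.

(** The undotted values enter as the hypothesis [IH] because this lemma is used inside the strong
    induction of [iter_tr_crossing]. *)
Lemma iter_tr_dotted a r
    (IH : forall b s, (s <= r)%N ->
      iter s tr (diag (b :: nseq s 0%N)) = s`!%:R *: sf_hsum b s) d :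
  iter r.+1 tr (diag (a :: rcons (nseq r 0%N) d)) = r`!%:R *: sf_trsum a r d.
Proof.
elim: r IH d => [|r IHr] IH d; rewrite iterSr -rcons_cons tr_rcons.
  rewrite /sf_trsum /trsum big_ord1 /= scale1r !hsum0 sf_h0 !scale1r big_seq1.
  by rewrite !addn0 addnS.
(* The dots of the closed strand become a scalar, land on the first strand, or land on a zero
   strand, as in the three terms of [trsumS]. *)
rewrite iter_trD iter_trZ iter_tr_sum sum_bumps_cons (IH _ r.+1) // (IH _ r.+1) //.
rewrite (sum_bumps_zeros [:: a]) cat1s IHr; last first.
  by move=> b s le_s; apply: IH; apply: leqW.
rewrite /sf_trsum trsumS -addrA !scalerDr addnS.
rewrite [in RHS]scalerA [_%:R * sf_pS d]mulrC -[in RHS]scalerA; congr (_ + (_ + _)).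
by rewrite !scaler_nat -mulrnA factS mulnC.
Qed.

(** The last undotted strand counts as a dotted one with [d = 0]. *)
Lemma iter_tr_crossing a r :
  iter r tr (diag (a :: nseq r 0%N)) = r`!%:R *: sf_hsum a r.
Proof.
have [m le_rm] := ubnP r; elim: m => // m IHm in a r le_rm *.
case: r le_rm => [|r] le_rm; first by rewrite /= scale1r /sf_hsum hsum0 sf_h0 scale1r.
rewrite -[in nseq _ _]addn1 nseqD cats1 iter_tr_dotted; last first.
  by move=> b s le_s; apply: IHm; exact: leq_ltn_trans le_s le_rm.
by rewrite /sf_trsum (trsum_newton _ sf_newton) !scaler_nat -mulrnA.
Qed.

Theorem theorem4p4 (n k : nat) (hn : (2 <= n)%N) :
  iter (n - 1)%N tr (dpartial k (crossing n)) =
  ((n - 2)`!)%:R *: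
    \sum_(2 <= i < n.+1)
      (((i - 1)%:R * sf_h (n - i)) *: dpartial (k + i - 1) strand
       + ((((k + i)%N)%:Z - n%:Z)%:~R * sf_h (k + i - 1))
           *: dpartial (n - i) strand).
Proof.
(* [r] is the number of strands between the first and the last. *)
have [r ->] : exists r, n = r.+2 by case: n hn => [|[|r]] //; exists r.
rewrite !subSS !subn0.
rewrite [X in iter _ tr X]/dpartial big_mkord iter_tr_sum.
transitivity (r`!%:R *: \sum_(j < k.+1) sf_h (k - j) *: sf_trsum 0 r j).
  rewrite scaler_sumr; apply: eq_bigr => j _.
  rewrite iter_trZ add_dots_crossing iter_tr_dotted.
    by rewrite !scalerA mulrC.
  by move=> b s _; apply: iter_tr_crossing.
rewrite (sum_trsum _ sf_newton); congr (_ *: _).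
(* With [i = c + 2], the factors [i - 1] and [k + i - n] become [c + 1] and [k + c - r]. *)
rewrite (big_addn 0 r.+3 2) subSS subSS subn0 big_mkord; apply: eq_bigr => c _.
rewrite !dpartial_strand addn2 !subSS !addnS !subSS !subn0.
have -> : (k + c).+2%:Z - r.+2%:Z = (k + c)%:Z - r%:Z by lia.
by rewrite intrB.
Qed.
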